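(* Let $R$ be a commutative ring with identity, let $M_1, M_2, N$ be $R$-modules, and let $f_j : M_j \to N$ ($j=1,2$) be $R$-linear maps. Let $p_1 : N\to N/\operatorname{Im}(f_1)$ be the natural quotient map. Then $$\ker(f_1\mid f_2) = \ker\bigl(p_1\circ f_2 : M_2\to N/\operatorname{Im}(f_1)\bigr).$$
   Context: For $R$-linear maps $f_1:M_1\to N$ and $f_2:M_2\to N$, the kernel of the pair is the subset (an $R$-submodule) of $M_2$ given by $\ker(f_1\mid f_2)=\{m_2\in M_2 \mid \exists m_1\in M_1 : f_1(m_1)+f_2(m_2)=0\}$. *)

(* Defs.v *)
From HB Require Import structures.
From mathcomp Require Import all_boot all_algebra.
From mathcomp Require Import boolp classical_sets.

Set Implicit Arguments.
Unset Strict Implicit.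
Unset Printing Implicit Defensive.

Import GRing.Theory.

Local Open Scope ring_scope.
Local Open Scope quotient_scope.
Local Open Scope classical_set_scope.

(* MathComp only provides the additive group V / W ([Quotient.quot]); the     *)
(* R-module structure a *: [x] := [a *: x] is added here.                     *)
Section QuotientModule.
Variables (R : pzRingType) (V : lmodType R) (W : submodClosed V).

(* [submodClosed] carries no closure under opposite, which [Quotient.quot]    *)
(* requires: the alias below adds it (- x = (- 1) *: x).                      *)
Definition submod_pred : {pred V} := [pred x | x \in W].

HB.instance Definition _ := GRing.isZmodClosed.Build V submod_pred
  (GRing.submod_closedB (GRing.submodClosedP W)).

Definition quotmod : Type := Quotient.quot submod_pred.

HB.instance Definition _ := ZmodQuotient.on quotmod.

Definition quotmod_proj : V -> quotmod := \pi_quotmod.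

Definition quotmod_scale (a : R) (q : quotmod) : quotmod :=
  quotmod_proj (a *: repr q).

Lemma quotmod_scaleE a x :
  quotmod_scale a (quotmod_proj x) = quotmod_proj (a *: x).
Proof.
rewrite /quotmod_scale /quotmod_proj; set r := repr _.
have rxW : r - x \in submod_pred by rewrite Quotient.idealrBE reprK.
apply/eqP; rewrite -[_ == _]/(_ == _ %[mod Quotient.quot submod_pred]).
by rewrite -Quotient.idealrBE -scalerBr inE rpredZ.
Qed.

Lemma quotmod_projD : {morph quotmod_proj : x y / x + y}.
Proof. by move=> x y; rewrite /quotmod_proj raddfD. Qed.

Lemma quotmod_projP q : exists x, q = quotmod_proj x.
Proof. by exists (repr q); rewrite /quotmod_proj reprK. Qed.

Lemma quotmod_scaleA a b q :
  quotmod_scale a (quotmod_scale b q) = quotmod_scale (a * b) q.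
Proof.
by have [x ->] := quotmod_projP q; rewrite !quotmod_scaleE scalerA.
Qed.

Lemma quotmod_scale1 : left_id 1 quotmod_scale.
Proof.
by move=> q; have [x ->] := quotmod_projP q; rewrite quotmod_scaleE scale1r.
Qed.

Lemma quotmod_scaleDr : right_distributive quotmod_scale +%R.
Proof.
move=> a p q; have [x ->] := quotmod_projP p; have [y ->] := quotmod_projP q.
by rewrite -quotmod_projD !quotmod_scaleE -quotmod_projD scalerDr.
Qed.

Lemma quotmod_scaleDl q : {morph quotmod_scale^~ q : a b / a + b}.
Proof.
move=> a b; have [x ->] := quotmod_projP q.
by rewrite !quotmod_scaleE -quotmod_projD scalerDl.
Qed.

HB.instance Definition _ := GRing.Zmodule_isLmodule.Build R quotmod
  quotmod_scaleA quotmod_scale1 quotmod_scaleDr quotmod_scaleDl.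

Lemma quotmod_proj_linear : linear quotmod_proj.
Proof.
move=> a x y; rewrite quotmod_projD.
by congr (_ + _); rewrite -[RHS]/(quotmod_scale a _) quotmod_scaleE.
Qed.

HB.instance Definition _ :=
  GRing.isLinear.Build R V quotmod *:%R quotmod_proj quotmod_proj_linear.

End QuotientModule.

Section ImageAndKernels.
Variable R : pzRingType.

(* A boolean predicate, as required by [submodClosed]; membership in the set  *)
(* [range f] is made boolean by classical logic.                              *)
Definition lin_image (M N : lmodType R) (f : {linear M -> N}) : {pred N} :=
  [pred y | y \in range f].

Lemma lin_image_submod_closed (M N : lmodType R) (f : {linear M -> N}) :
  submod_closed (lin_image f).
Proof.
split=> [|a u v]; rewrite !inE; first by exists 0 => //; rewrite linear0.
by move=> [x _ <-] [y _ <-]; exists (a *: x + y) => //; rewrite linearP.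
Qed.

HB.instance Definition _ (M N : lmodType R) (f : {linear M -> N}) :=
  GRing.isSubmodClosed.Build R N (lin_image f) (lin_image_submod_closed f).

Definition lin_ker (M N : lmodType R) (f : {linear M -> N}) : set M :=
  [set x | f x = 0].

Definition ker_pair (M1 M2 N : lmodType R)
    (f1 : {linear M1 -> N}) (f2 : {linear M2 -> N}) : set M2 :=
  [set m2 | exists m1 : M1, f1 m1 + f2 m2 = 0].

Lemma ker_pair_submod_closed (M1 M2 N : lmodType R)
    (f1 : {linear M1 -> N}) (f2 : {linear M2 -> N}) :
  submod_closed (mem (ker_pair f1 f2)).
Proof.
split=> [|a u v]; rewrite !inE; first by exists 0; rewrite !linear0 addr0.
move=> [x fxu] [y fyv]; exists (a *: x + y).
by rewrite !linearP addrACA -scalerDr fxu fyv scaler0 addr0.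
Qed.

End ImageAndKernels.

(* Main.v *)
Require Import Defs.
From mathcomp Require Import all_boot all_algebra.
From mathcomp Require Import boolp classical_sets.

(** An element [m2] is killed by the composite exactly when [f2 m2] lies in the
    image of [f1], since the kernel of a quotient map is the submodule divided
    out ([quotmod_proj_eq0]).  This differs from the existence of [m1] with
    [f1 m1 + f2 m2 = 0] only by a sign, which [m1 |-> - m1] absorbs. *)

Import GRing.Theory.
Local Open Scope ring_scope.
Local Open Scope quotient_scope.

Lemma quotmod_proj_eq0 (R : pzRingType) (V : lmodType R) (W : submodClosed V)
    (x : V) : (quotmod_proj W x == 0) = (x \in W).
Proof.
rewrite -(linear0 (quotmod_proj W)).
rewrite -[_ == _]/(_ == _ %[mod Quotient.quot (submod_pred W)]).
by rewrite -Quotient.idealrBE subr0 inE.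
Qed.

Theorem proposition2p3 (R : comPzRingType) (M1 M2 N : lmodType R)
    (f1 : {linear M1 -> N}) (f2 : {linear M2 -> N}) :
  ker_pair f1 f2 = lin_ker (quotmod_proj (lin_image f1) \o f2).
Proof.
apply/seteqP; split=> m2 /=.
- move=> [m1 /eqP]; rewrite addrC addr_eq0 => /eqP f2E.
  apply/eqP; rewrite quotmod_proj_eq0 !inE.
  by exists (- m1); rewrite // linearN f2E.
- move/eqP; rewrite quotmod_proj_eq0 !inE => -[m1 _ f1E].
  by exists (- m1); rewrite linearN f1E addNr.
Qed.
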